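(* The category of pointed objects of a Boolean pretopos satisfies axioms (A1)–(A6). The same holds for the full subcategory of noninitial objects of a nondegenerate two-valued Boolean pretopos.
   Context: AXIOMS (for a category $\mathcal C$, not necessarily small). A monomorphism $m:A\to B$ is strong if for every epimorphism $e:P\to Q$ and all $a:P\to A$, $b:Q\to B$ with $ma=be$ there is $\ell:Q\to A$ with $\ell e=a$ and $m\ell=b$. (A1) There is a terminal object $1$; $q_X:X\to 1$ is the unique morphism, and a point of $Y$ is a morphism $1\to Y$ in $\mathcal C$. (A2) Every morphism factors as $me$ with $e$ an epimorphism and $m$ a strong monomorphism. (A3) For every epimorphism $d:X\to Y$ and strong monomorphism $v:B\to Y$ the pullback of $d$ and $v$ exists and its projection to $B$ is an epimorphism. (A4) For every strong monomorphism $u:A\to X$ and epimorphism $a:A\to B$ there is a pushout square $cu=va$ ($c:X\to Y$, $v:B\to Y$) with $v$ a strong monomorphism, and this square is also a pullback. (A5) The class of epimorphisms whose pullbacks along all but at most one point of their codomain are isomorphisms is stable under pushout along strong monomorphisms. (The pullback of $d:X\to Y$ along a point $1\to Y$ is the projection $X\times_Y1\to1$.) (A6) For every object $A$ and point $j:1\to B$ the following category has a terminal object: objects are triples $(C,d,u)$ with $u:A\to C$ a strong monomorphism and $d:C\to B$ an epimorphism such that the square $du=jq_A$ is a pullback; morphisms $(C',d',u')\to(C,d,u)$ are morphisms $h:C'\to C$ with $hu'=u$ and $dh=d'$. DEFINITIONS. A regular epimorphism is a coequalizer of a pair of morphisms. A pretopos is a category with finite limits, disjoint finite coproducts stable under pullback,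 and pullback-stable (regular epimorphism, monomorphism)-factorizations, in which every internal equivalence relation is the kernel pair of its quotient. A pretopos is Boolean if every subobject has a complement (a monomorphism $A\to X$ identifies $X$ with a coproduct $A+D$). It is two-valued if the only subobjects of $1$ are $0$ and $1$, and nondegenerate if these are distinct. A pointed object is an object $X$ with a specified morphism $x:1\to X$; morphisms of pointed objects preserve the specified points. *)

(* Defs.v *)
From mathcomp Require Import all_boot boolp.

Set Implicit Arguments.
Unset Strict Implicit.
Unset Printing Implicit Defensive.

Declare Scope cat_scope.
Delimit Scope cat_scope with cat.
Local Open Scope cat_scope.

Record category : Type := Category {
  obj :> Type;
  hom : obj -> obj -> Type;
  idm : forall X, hom X X;
  comp : forall X Y Z, hom Y Z -> hom X Y -> hom X Z;
  comp_idl : forall X Y (f : hom X Y), comp (idm Y) f = f;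
  comp_idr : forall X Y (f : hom X Y), comp f (idm X) = f;
  compA : forall W X Y Z (h : hom Y Z) (g : hom X Y) (f : hom W X),
    comp h (comp g f) = comp (comp h g) f }.

Arguments hom {c} X Y.
Arguments idm {c} X.
Arguments comp {c X Y Z} g f.

Notation "g ∘ f" := (comp g f) (at level 40, left associativity) : cat_scope.

Section Basics.
Variable C : category.

Definition is_iso (X Y : C) (f : hom X Y) : Prop :=
  exists g : hom Y X, g ∘ f = idm X /\ f ∘ g = idm Y.

Definition mono (X Y : C) (m : hom X Y) : Prop :=
  forall W (f g : hom W X), m ∘ f = m ∘ g -> f = g.

Definition epi (X Y : C) (e : hom X Y) : Prop :=
  forall Z (f g : hom Y Z), f ∘ e = g ∘ e -> f = g.

Definition strong_mono (A B : C) (m : hom A B) : Prop :=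
  mono m /\
  forall (P Q : C) (e : hom P Q) (a : hom P A) (b : hom Q B),
    epi e -> m ∘ a = b ∘ e -> exists l : hom Q A, l ∘ e = a /\ m ∘ l = b.

Definition is_coequalizer (R X Q : C) (r0 r1 : hom R X) (q : hom X Q) : Prop :=
  q ∘ r0 = q ∘ r1 /\
  forall Z (f : hom X Z), f ∘ r0 = f ∘ r1 -> exists! h : hom Q Z, h ∘ q = f.

Definition regular_epi (X Q : C) (q : hom X Q) : Prop :=
  exists (R : C) (r0 r1 : hom R X), is_coequalizer r0 r1 q.

(* [p : P -> X] and [q : P -> Y] are the projections of the pullback
   of [f : X -> Z] and [g : Y -> Z]. *)
Definition is_pullback (X Y Z P : C) (f : hom X Z) (g : hom Y Z)
    (p : hom P X) (q : hom P Y) : Prop :=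
  f ∘ p = g ∘ q /\
  forall W (a : hom W X) (b : hom W Y), f ∘ a = g ∘ b ->
    exists! h : hom W P, p ∘ h = a /\ q ∘ h = b.

(* [c : X -> Q] and [v : B -> Q] are the coprojections of the pushout
   of [u : A -> X] and [a : A -> B]. *)
Definition is_pushout (A X B Q : C) (u : hom A X) (a : hom A B)
    (c : hom X Q) (v : hom B Q) : Prop :=
  c ∘ u = v ∘ a /\
  forall Z (f : hom X Z) (g : hom B Z), f ∘ u = g ∘ a ->
    exists! h : hom Q Z, h ∘ c = f /\ h ∘ v = g.

Definition is_initial (Z : C) : Prop := forall X, exists! f : hom Z X, True.

Record terminal : Type := Terminal {
  tobj :> obj C;
  tmap : forall X, hom X tobj;
  tmap_uniq : forall X (f : hom X tobj), f = tmap X }.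

Definition is_binary_coproduct (A D X : C) (a : hom A X) (d : hom D X) : Prop :=
  forall Z (f : hom A Z) (g : hom D Z),
    exists! h : hom X Z, h ∘ a = f /\ h ∘ d = g.

Definition is_coproduct (I : Type) (F : I -> C) (S : C)
    (inj : forall i, hom (F i) S) : Prop :=
  forall Z (f : forall i, hom (F i) Z),
    exists! h : hom S Z, forall i, h ∘ inj i = f i.

(* Diagrams are indexed by a graph with vertices [V], edges [E], source [s]
   and target [t]; a functor on a finite category is a case of this, with the
   same cones. *)
Definition is_limit (V E : Type) (s t : E -> V) (D : V -> C)
    (De : forall e, hom (D (s e)) (D (t e)))
    (L : C) (p : forall v, hom L (D v)) : Prop :=
  (forall e, De e ∘ p (s e) = p (t e)) /\
  forall (W : C) (w : forall v, hom W (D v)),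
    (forall e, De e ∘ w (s e) = w (t e)) ->
    exists! h : hom W L, forall v, p v ∘ h = w v.

Definition has_finite_limits : Prop :=
  forall (V E : finType) (s t : E -> V) (D : V -> C)
    (De : forall e, hom (D (s e)) (D (t e))),
  exists (L : C) (p : forall v, hom L (D v)), is_limit De p.

Definition has_finite_coproducts : Prop :=
  forall (I : finType) (F : I -> C),
  exists (S : C) (inj : forall i, hom (F i) S), is_coproduct inj.

Definition finite_coproducts_disjoint : Prop :=
  forall (I : finType) (F : I -> C) (S : C) (inj : forall i, hom (F i) S),
  is_coproduct inj ->
  (forall i, mono (inj i)) /\
  (forall i j, i <> j -> forall P (p : hom P (F i)) (q : hom P (F j)),
     is_pullback (inj i) (inj j) p q -> is_initial P).

Definition finite_coproducts_stable : Prop :=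
  forall (I : finType) (F : I -> C) (S : C) (inj : forall i, hom (F i) S),
  is_coproduct inj ->
  forall (Y : C) (f : hom Y S) (G : I -> C)
    (p : forall i, hom (G i) Y) (q : forall i, hom (G i) (F i)),
  (forall i, is_pullback f (inj i) (p i) (q i)) -> is_coproduct p.

Definition has_regular_factorizations : Prop :=
  forall (X Y : C) (f : hom X Y),
  exists (I : C) (e : hom X I) (m : hom I Y),
    [/\ f = m ∘ e, regular_epi e & mono m].

(* The pullback along [g] of the factorization [m ∘ e] is [m' ∘ e']. *)
Definition regular_factorizations_stable : Prop :=
  forall (X I Y : C) (e : hom X I) (m : hom I Y), regular_epi e -> mono m ->
  forall (Y' : C) (g : hom Y' Y)
    (I' : C) (m' : hom I' Y') (gI : hom I' I)
    (X' : C) (e' : hom X' I') (gX : hom X' X),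
  is_pullback m g gI m' -> is_pullback e gI gX e' ->
  regular_epi e' /\ mono m'.

Record equivalence_relation (R X : C) (r0 r1 : hom R X) : Prop := {
  eqrel_jointly_monic : forall W (f g : hom W R),
    r0 ∘ f = r0 ∘ g -> r1 ∘ f = r1 ∘ g -> f = g;
  eqrel_refl : exists r : hom X R, r0 ∘ r = idm X /\ r1 ∘ r = idm X;
  eqrel_sym : exists s : hom R R, r0 ∘ s = r1 /\ r1 ∘ s = r0;
  eqrel_trans : forall P (p q : hom P R), is_pullback r1 r0 p q ->
    exists t : hom P R, r0 ∘ t = r0 ∘ p /\ r1 ∘ t = r1 ∘ q }.

Definition equivalence_relations_effective : Prop :=
  forall (R X : C) (r0 r1 : hom R X), equivalence_relation r0 r1 ->
  exists (Q : C) (q : hom X Q),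
    is_coequalizer r0 r1 q /\ is_pullback q q r0 r1.

Record pretopos : Prop := {
  pretopos_limits : has_finite_limits;
  pretopos_coproducts : has_finite_coproducts;
  pretopos_disjoint : finite_coproducts_disjoint;
  pretopos_coproducts_stable : finite_coproducts_stable;
  pretopos_factorizations : has_regular_factorizations;
  pretopos_factorizations_stable : regular_factorizations_stable;
  pretopos_effective : equivalence_relations_effective }.

Definition boolean : Prop :=
  forall (A X : C) (a : hom A X), mono a ->
  exists (D : C) (d : hom D X), is_binary_coproduct a d.

(* A subobject [U] of 1 is the subobject 0 iff [U] is initial, and the
   subobject 1 iff its inclusion is invertible. *)
Definition two_valued : Prop :=
  forall (T : terminal) (U : C) (m : hom U T), mono m ->
  is_initial U \/ is_iso m.

Definition nondegenerate : Prop :=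
  forall (T : terminal) (Z : C) (z : hom Z T), is_initial Z -> ~ is_iso z.

End Basics.

Section FullSubcategory.
Variables (C : category) (P : C -> Prop).

Record full_obj : Type := FullObj { full_val :> C; full_valP : P full_val }.

Definition full_subcategory : category :=
  @Category full_obj (fun X Y => hom (full_val X) (full_val Y))
    (fun X => idm (full_val X)) (fun X Y Z g f => g ∘ f)
    (fun X Y f => comp_idl f) (fun X Y f => comp_idr f)
    (fun W X Y Z h g f => compA h g f).

End FullSubcategory.

Definition noninitial_objects (C : category) : category :=
  full_subcategory (fun X : C => ~ is_initial X).

Section Pointed.
Variables (C : category) (T : terminal C).

Record ptd_obj : Type := PtdObj { ptd_val :> C; ptd_pt : hom T ptd_val }.

Definition ptd_hom (X Y : ptd_obj) : Type :=
  {f : hom X Y | f ∘ ptd_pt X = ptd_pt Y}.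

Definition ptd_id (X : ptd_obj) : ptd_hom X X := exist _ _ (comp_idl (ptd_pt X)).

Lemma ptd_compP (X Y Z : ptd_obj) (g : ptd_hom Y Z) (f : ptd_hom X Y) :
  sval g ∘ sval f ∘ ptd_pt X = ptd_pt Z.
Proof. by rewrite -compA (svalP f) (svalP g). Qed.

Definition ptd_comp (X Y Z : ptd_obj) (g : ptd_hom Y Z) (f : ptd_hom X Y) :
  ptd_hom X Z := exist _ _ (ptd_compP g f).

Lemma ptd_hom_inj (X Y : ptd_obj) (f g : ptd_hom X Y) : sval f = sval g -> f = g.
Proof. by case: f g => [f fP] [g gP]; exact: eq_exist. Qed.

Lemma ptd_idl (X Y : ptd_obj) (f : ptd_hom X Y) : ptd_comp (ptd_id Y) f = f.
Proof. exact/ptd_hom_inj/comp_idl. Qed.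

Lemma ptd_idr (X Y : ptd_obj) (f : ptd_hom X Y) : ptd_comp f (ptd_id X) = f.
Proof. exact/ptd_hom_inj/comp_idr. Qed.

Lemma ptd_compA (W X Y Z : ptd_obj) (h : ptd_hom Y Z) (g : ptd_hom X Y)
    (f : ptd_hom W X) :
  ptd_comp h (ptd_comp g f) = ptd_comp (ptd_comp h g) f.
Proof. exact/ptd_hom_inj/compA. Qed.

Definition pointed_objects : category :=
  Category ptd_idl ptd_idr ptd_compA.

End Pointed.

Section Conditions.
Variable C : category.

Definition axiomA2 : Prop :=
  forall (X Y : C) (f : hom X Y),
  exists (I : C) (e : hom X I) (m : hom I Y),
    [/\ f = m ∘ e, epi e & strong_mono m].

Definition axiomA3 : Prop :=
  forall (X Y B : C) (d : hom X Y) (v : hom B Y), epi d -> strong_mono v ->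
  exists (P : C) (p : hom P X) (q : hom P B), is_pullback d v p q /\ epi q.

Definition axiomA4 : Prop :=
  forall (A X B : C) (u : hom A X) (a : hom A B), strong_mono u -> epi a ->
  exists (Y : C) (c : hom X Y) (v : hom B Y),
    [/\ is_pushout u a c v, strong_mono v & is_pullback c v u a].

Variable T : terminal C.

Definition iso_over_point (X Y : C) (d : hom X Y) (y : hom T Y) : Prop :=
  exists (P : C) (p : hom P X) (q : hom P T), is_pullback d y p q /\ is_iso q.

Definition almost_iso_epi (X Y : C) (d : hom X Y) : Prop :=
  epi d /\
  forall y y' : hom T Y,
    ~ iso_over_point d y -> ~ iso_over_point d y' -> y = y'.

Definition axiomA5 : Prop :=
  forall (X Y X' Y' : C) (d : hom X Y) (u : hom X X')
    (c : hom X' Y') (v : hom Y Y'),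
  almost_iso_epi d -> strong_mono u -> is_pushout u d c v -> almost_iso_epi c.

Section Extensions.
Variables (A B : C) (j : hom T B).

Record ext_obj : Type := ExtObj {
  ext_val : C;
  ext_d : hom ext_val B;
  ext_u : hom A ext_val;
  ext_u_strong : strong_mono ext_u;
  ext_d_epi : epi ext_d;
  ext_pullback : is_pullback ext_d j ext_u (tmap T A) }.

Definition ext_hom (E' E : ext_obj) : Type :=
  {h : hom (ext_val E') (ext_val E) |
    h ∘ ext_u E' = ext_u E /\ ext_d E ∘ h = ext_d E'}.

Definition ext_id (E : ext_obj) : ext_hom E E :=
  exist _ _ (conj (comp_idl (ext_u E)) (comp_idr (ext_d E))).

Lemma ext_compP (E1 E2 E3 : ext_obj) (g : ext_hom E2 E3) (f : ext_hom E1 E2) :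
  (sval g ∘ sval f) ∘ ext_u E1 = ext_u E3 /\
  ext_d E3 ∘ (sval g ∘ sval f) = ext_d E1.
Proof.
by case: g f => [g [gu gd]] [f [fu fd]] /=; rewrite -compA fu compA gd.
Qed.

Definition ext_comp (E1 E2 E3 : ext_obj) (g : ext_hom E2 E3)
  (f : ext_hom E1 E2) : ext_hom E1 E3 := exist _ _ (ext_compP g f).

Lemma ext_hom_inj (E F : ext_obj) (f g : ext_hom E F) : sval f = sval g -> f = g.
Proof. by case: f g => [f fP] [g gP]; exact: eq_exist. Qed.

Lemma ext_idl (E F : ext_obj) (f : ext_hom E F) : ext_comp (ext_id F) f = f.
Proof. exact/ext_hom_inj/comp_idl. Qed.

Lemma ext_idr (E F : ext_obj) (f : ext_hom E F) : ext_comp f (ext_id E) = f.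
Proof. exact/ext_hom_inj/comp_idr. Qed.

Lemma ext_compA (E F G H : ext_obj) (h : ext_hom G H) (g : ext_hom F G)
    (f : ext_hom E F) :
  ext_comp h (ext_comp g f) = ext_comp (ext_comp h g) f.
Proof. exact/ext_hom_inj/compA. Qed.

Definition ext_category : category :=
  Category ext_idl ext_idr ext_compA.

End Extensions.

Definition axiomA6 : Prop :=
  forall (A B : C) (j : hom T B), inhabited (terminal (ext_category A j)).

End Conditions.

Definition satisfies_A1_A6 (C : category) : Prop :=
  exists T : terminal C,
    [/\ axiomA2 C, axiomA3 C, axiomA4 C, axiomA5 T & axiomA6 T].

(* Main.v *)
(* Complements turn a pushout of a : A -> B along a monomorphism u : A -> X into
   a coproduct: if X = A + D, the pushout is B + D with the map a + id_D.  This
   square is also a pullback, and a + id_D is an isomorphism over every point of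
   D; in a two-valued pretopos every point of B + D lies in B or in D.  For (A6),
   if B = 1 + B' then every extension (C, d, u) has C = A + D with D lying over
   B', so A + B' is terminal.  In both categories the epimorphisms are the regular
   epimorphisms of the pretopos and the strong monomorphisms are its
   monomorphisms. *)
From mathcomp Require Import all_boot boolp.
Require Import Defs.

Set Implicit Arguments.
Unset Strict Implicit.
Unset Printing Implicit Defensive.

Local Open Scope cat_scope.

(** * Squares, regular epimorphisms and binary coproducts in an arbitrary category *)

Section CategoryFacts.
Variable C : category.

Lemma terminal_hom_eq (T : terminal C) (X : C) (f g : hom X T) : f = g.
Proof. by rewrite (tmap_uniq f) (tmap_uniq g). Qed.

Lemma initial_hom_eq (Z X : C) (f g : hom Z X) : is_initial Z -> f = g.
Proof. by move=> /(_ X) [h [_ hu]]; rewrite -(hu f I) -(hu g I). Qed.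

Lemma terminal_point_mono (T : terminal C) (X : C) (x : hom T X) : mono x.
Proof. by move=> W f g _; exact: terminal_hom_eq. Qed.

Lemma epi_pushout (A X B Q : C) (u : hom A X) (a : hom A B) (c : hom X Q)
    (v : hom B Q) : is_pushout u a c v -> epi a -> epi c.
Proof.
move=> [cu po] ea Z f g fg.
have fgv : f ∘ v = g ∘ v.
  by apply: ea; rewrite -!compA -cu !compA fg.
have [h [_ hu]] := po Z (f ∘ c) (f ∘ v) ltac:(by rewrite -!compA cu).
by rewrite -(hu f) // -(hu g) // fg fgv.
Qed.

Lemma pushout_iso (A X B Q Q' : C) (u : hom A X) (a : hom A B)
    (c : hom X Q) (v : hom B Q) (c' : hom X Q') (v' : hom B Q') :
  is_pushout u a c v -> is_pushout u a c' v' ->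
  exists k : hom Q Q', [/\ is_iso k, k ∘ c = c' & k ∘ v = v'].
Proof.
move=> [cu po] [cu' po'].
have [k [[kc kv] _]] := po _ _ _ cu'.
have [k' [[kc' kv'] _]] := po' _ _ _ cu.
exists k; split=> //; exists k'; split.
  have [h [_ hu]] := po _ _ _ cu.
  rewrite -(hu (idm Q)) ?comp_idl // -(hu (k' ∘ k)) //.
  by rewrite -!compA kc kv.
have [h [_ hu]] := po' _ _ _ cu'.
rewrite -(hu (idm Q')) ?comp_idl // -(hu (k ∘ k')) //.
by rewrite -!compA kc' kv'.
Qed.

Lemma pullback_paste (X Y Z P X' Y' : C) (f : hom X Z) (g : hom Y Z)
    (p : hom P X) (q : hom P Y) (y : hom X' Y) (p' : hom Y' P) (q' : hom Y' X') :
  is_pullback f g p q -> is_pullback q y p' q' ->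
  is_pullback f (g ∘ y) (p ∘ p') q'.
Proof.
move=> [fp pb] [qp pb']; split.
  by rewrite compA fp -compA qp compA.
move=> W a b fa.
have [h [[ph qh] hu]] := pb W a (y ∘ b) ltac:(by rewrite fa compA).
have [k [[pk qk] ku]] := pb' W h b qh.
exists k; split; first by rewrite -compA pk.
move=> k' [pk' qk']; apply: ku; split=> //.
by symmetry; apply: hu; rewrite !compA -qk' compA qp.
Qed.

Lemma regular_epi_epi (X Y : C) (e : hom X Y) : regular_epi e -> epi e.
Proof.
move=> [R [r0 [r1 [er uni]]]] Z f g fg.
have [h [_ hu]] := uni Z (f ∘ e) ltac:(by rewrite -!compA er).
by rewrite -(hu f) // -(hu g).
Qed.

(** Since [m] is a monomorphism, [a] coequalizes the pair that [e] coequalizes, so it descends along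
    [e]. Hence wherever all epimorphisms are regular, all monomorphisms are strong. *)
Lemma regular_epi_mono_lift (P Q A B : C) (e : hom P Q) (m : hom A B)
    (a : hom P A) (b : hom Q B) :
  regular_epi e -> mono m -> m ∘ a = b ∘ e ->
  exists l : hom Q A, l ∘ e = a /\ m ∘ l = b.
Proof.
move=> re mm mab; have ee := regular_epi_epi re.
have [R [r0 [r1 [er uni]]]] := re.
have [|l [le _]] := uni A a.
  by apply: mm; rewrite !compA mab -!compA er.
by exists l; split=> //; apply: ee; rewrite -compA le.
Qed.

Lemma regular_epi_iso_comp (X Y Z : C) (e : hom X Y) (k : hom Y Z) :
  regular_epi e -> is_iso k -> regular_epi (k ∘ e).
Proof.
move=> [R [r0 [r1 [er uni]]]] [k' [k'k kk']]; exists R, r0, r1; split.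
  by rewrite -!compA er.
move=> W f fr; have [h [he hu]] := uni W f fr.
exists (h ∘ k'); split; first by rewrite -compA (compA k') k'k comp_idl.
by move=> h' h'f; rewrite (hu (h' ∘ k)) -compA ?kk' ?comp_idr.
Qed.

Section BinaryCoproducts.
Variables (A D X : C) (a : hom A X) (d : hom D X).
Hypothesis X_sum : is_binary_coproduct a d.

Lemma bincop_sym : is_binary_coproduct d a.
Proof.
move=> Z f g; have [h [[ha hd] hu]] := X_sum g f.
by exists h; split=> // h' [? ?]; apply: hu.
Qed.

Lemma bincop_hom_eq (Z : C) (f g : hom X Z) :
  f ∘ a = g ∘ a -> f ∘ d = g ∘ d -> f = g.
Proof.
move=> fa fd; have [h [_ hu]] := X_sum (f ∘ a) (f ∘ d).
by rewrite -(hu f) // -(hu g).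
Qed.

Lemma bincop_initial_iso : is_initial D -> is_iso a.
Proof.
move=> D0; have [f _] := D0 A.
have [h [[ha hd] _]] := X_sum (idm A) f.
exists h; split=> //; apply: bincop_hom_eq; last exact: initial_hom_eq.
by rewrite -compA ha comp_idr comp_idl.
Qed.

Lemma bincop_iso_comp (Y : C) (k : hom X Y) :
  is_iso k -> is_binary_coproduct (k ∘ a) (k ∘ d).
Proof.
move=> [k' [k'k kk']] Z f g; have [h [[ha hd] hu]] := X_sum f g.
exists (h ∘ k'); split.
  by rewrite -!compA !(compA k') k'k !comp_idl.
move=> h' [h'a h'd]; rewrite (hu (h' ∘ k)) -?compA ?kk' ?comp_idr //.
Qed.

(** Disjointness and stability are formulated for families over a finite type; the index type [bool]
    makes them available for binary coproducts. *)
Lemma bincop_coproduct :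
  is_coproduct (F := fun b : bool => if b then A else D)
    (fun b => if b return hom (if b then A else D) X then a else d).
Proof.
move=> Z f; have [h [[ha hd] hu]] := X_sum (f true) (f false).
exists h; split; first by case.
by move=> h' h'f; apply: hu; split; [exact: (h'f true)|exact: (h'f false)].
Qed.

End BinaryCoproducts.

End CategoryFacts.

(** * Limits, disjointness and stability in a pretopos *)

Section BooleanPretopos.
Variable C : category.
Hypothesis C_pretopos : pretopos C.

Lemma ex_terminal : inhabited (terminal C).
Proof.
have [L [p [_ uni]]] := @pretopos_limits _ C_pretopos void void
  id id (of_void C) (fun e => match e with end).
have Q X : exists! h : hom X L, True.
  have [|h [_ hu]] := uni X (fun v => match v with end); first by case.
  by exists h; split=> // h' _; apply: hu; case.
(* [tmap] is a function, so a morphism to [L] has to be chosen for each [X]. *)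
pose t X := cid (Q X).
by constructor; exists L (fun X => sval (t X)) => X f;
  case: (t X) => g [_ gu] /=; rewrite (gu f).
Qed.

Lemma ex_pullback (X Y Z : C) (f : hom X Z) (g : hom Y Z) :
  exists (P : C) (p : hom P X) (q : hom P Y), is_pullback f g p q.
Proof.
(* The cospan as a graph: [Some true] and [Some false] carry [X] and [Y], and both edges end at
   [None], which carries [Z]. *)
pose D (v : option bool) : C := if v is Some b then if b then X else Y else Z.
pose De (b : bool) : hom (D (Some b)) (D None) :=
  if b return hom (D (Some b)) (D None) then f else g.
have [L [p [pc uni]]] := @pretopos_limits _ C_pretopos _ _
  (fun b : bool => Some b) (fun _ : bool => None) D De.
exists L, (p (Some true)), (p (Some false)); split.
  by rewrite (pc true) (pc false).
move=> W a b ab.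
pose w (v : option bool) : hom W (D v) :=
  match v return hom W (D v) with
  | Some c => if c return hom W (D (Some c)) then a else b
  | None => f ∘ a end.
have [|h [hw hu]] := uni W w; first by case.
exists h; split.
  by split; [exact: (hw (Some true))|exact: (hw (Some false))].
move=> h' [h'a h'b]; apply: hu => -[[]|] //=.
by rewrite -(pc true) -compA h'a.
Qed.

Lemma ex_bincop (A D : C) :
  exists (X : C) (a : hom A X) (d : hom D X), is_binary_coproduct a d.
Proof.
have [S [i uni]] := @pretopos_coproducts _ C_pretopos bool
  (fun b : bool => if b then A else D).
exists S, (i true), (i false) => Z f g.
have [h [hf hu]] := uni Z
  (fun b => if b return hom (if b then A else D) Z then f else g).
exists h; split; first by split; [exact: (hf true)|exact: (hf false)].
by move=> h' [? ?]; apply: hu; case.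
Qed.

(** [Z] is the coproduct of the empty family. Stability along [f] has no squares to check, so [Y] is
    an empty coproduct too. *)
Lemma initial_strict (Y Z : C) (f : hom Y Z) : is_initial Z -> is_initial Y.
Proof.
move=> Z0.
have cZ : is_coproduct (I := void) (F := of_void C) (S := Z)
    (fun i => match i with end).
  move=> W g; have [h [_ hu]] := Z0 W.
  by exists h; split=> [[]|h' _]; exact: hu.
have cY := pretopos_coproducts_stable C_pretopos cZ (f := f) (G := of_void C)
  (p := fun i => match i with end) (q := fun i => match i with end)
  (fun i => match i with end).
move=> W; have [h [_ hu]] := cY W (fun i => match i with end).
by exists h; split=> // h' _; apply: hu; case.
Qed.

Lemma bincop_monol (A D X : C) (a : hom A X) (d : hom D X) :
  is_binary_coproduct a d -> mono a.
Proof.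
move=> /bincop_coproduct cX.
by have [/(_ true)] := pretopos_disjoint C_pretopos cX.
Qed.

Lemma bincop_monor (A D X : C) (a : hom A X) (d : hom D X) :
  is_binary_coproduct a d -> mono d.
Proof. by move=> /bincop_sym /bincop_monol. Qed.

(** [W] maps to the intersection of the two summands, which is initial by disjointness, and initial
    objects are strict. *)
Lemma bincop_disjoint (A D X W : C) (a : hom A X) (d : hom D X)
    (x : hom W A) (y : hom W D) :
  is_binary_coproduct a d -> a ∘ x = d ∘ y -> is_initial W.
Proof.
move=> /bincop_coproduct cX xy.
have [_ dis] := pretopos_disjoint C_pretopos cX.
have [P [p [q pb]]] := ex_pullback a d.
have P0 : is_initial P by exact: (dis true false _ P p q pb).
have [h _] := pb.2 W x y xy.
exact: initial_strict h P0.
Qed.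

Lemma bincop_stable (A D X Y A' D' : C) (a : hom A X) (d : hom D X)
    (f : hom Y X) (a' : hom A' Y) (d' : hom D' Y) (f1 : hom A' A)
    (f2 : hom D' D) :
  is_binary_coproduct a d ->
  is_pullback f a a' f1 -> is_pullback f d d' f2 -> is_binary_coproduct a' d'.
Proof.
move=> /bincop_coproduct cX pb1 pb2.
have /= cY := pretopos_coproducts_stable C_pretopos cX (f := f)
  (G := fun b : bool => if b then A' else D')
  (p := fun b => if b return hom (if b then A' else D') Y then a' else d')
  (q := fun b => if b return hom (if b then A' else D') (if b then A else D)
                 then f1 else f2) ltac:(by case).
move=> Z g1 g2; have [h [hg hu]] := cY Z
  (fun b => if b return hom (if b then A' else D') Z then g1 else g2).
exists h; split; first by split; [exact: (hg true)|exact: (hg false)].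
by move=> h' [? ?]; apply: hu; case.
Qed.

(** Pulling the sum back along [x] splits [W] into a part over [A] and a part over [D]. The second
    is initial by assumption, so the first is all of [W], and its projection to [A] gives the
    factorization. *)
Lemma bincop_factor (A D X W : C) (a : hom A X) (d : hom D X) (x : hom W X) :
  is_binary_coproduct a d ->
  (forall V (k : hom V W) (y : hom V D), x ∘ k = d ∘ y -> is_initial V) ->
  exists h : hom W A, a ∘ h = x.
Proof.
move=> cX xd.
have [P [p [q pb]]] := ex_pullback x a.
have [V [k [y pb']]] := ex_pullback x d.
have [r [_ pr]] :=
  bincop_initial_iso (bincop_stable cX pb pb') (xd _ _ _ pb'.1).
by exists (q ∘ r); rewrite compA -pb.1 -compA pr comp_idr.
Qed.

(** The stability axiom concerns factorizations [m ∘ e]; it is applied with [m] an identity. *)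
Lemma epi_stable (X Y Y' P : C) (e : hom X Y) (g : hom Y' Y) (p : hom P X)
    (q : hom P Y') : regular_epi e -> is_pullback e g p q -> epi q.
Proof.
move=> re pb; apply: regular_epi_epi.
have idm_mono : mono (idm Y) by move=> W f h; rewrite !comp_idl.
have pb_id : is_pullback (idm Y) g g (idm Y').
  split=> [|W a b]; first by rewrite comp_idl comp_idr.
  rewrite comp_idl => ab; exists b; split; first by rewrite comp_idl.
  by move=> b' []; rewrite comp_idl.
by have [] :=
  pretopos_factorizations_stable C_pretopos re idm_mono pb_id pb.
Qed.

(** * The map [a + id_D] between sums *)

Section SumMap.
Variables (A B D X Y : C) (u : hom A X) (d : hom D X) (v : hom B Y)
  (w : hom D Y) (a : hom A B) (c : hom X Y).
Hypotheses (X_sum : is_binary_coproduct u d) (Y_sum : is_binary_coproduct v w).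
Hypotheses (cu : c ∘ u = v ∘ a) (cd : c ∘ d = w).

Lemma summap_pushout : is_pushout u a c v.
Proof.
split=> // Z f g fg; have [h [[hv hw] hu]] := Y_sum g (f ∘ d).
exists h; split.
  split=> //; apply: (bincop_hom_eq X_sum); last by rewrite -compA cd.
  by rewrite -compA cu compA hv fg.
by move=> h' [h'c h'v]; apply: hu; rewrite -cd compA h'c.
Qed.

(** A morphism [x] with [c ∘ x = v ∘ b] cannot meet [D]: on the overlap [c] would land in [B] and in
    [D] at once. So [x] factors through [u]. *)
Lemma summap_pullback : is_pullback c v u a.
Proof.
split=> // W x b xb.
have [|h uh] := bincop_factor (x := x) X_sum.
  move=> V k y xk; apply: (bincop_disjoint (x := b ∘ k) (y := y) Y_sum).
  by rewrite compA -xb -compA xk compA cd.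
exists h; split.
  by split=> //; apply: (bincop_monol Y_sum); rewrite compA -cu -compA uh.
by move=> h' [uh' _]; apply: (bincop_monol X_sum); rewrite uh uh'.
Qed.

(** The same argument with the summands exchanged: [x] cannot meet [A], and [c] is monic on [D].
    This makes [c] an isomorphism over [D]. *)
Lemma summap_fiber (W : C) (x : hom W X) (s : hom W D) :
  c ∘ x = w ∘ s -> x = d ∘ s.
Proof.
move=> xs; have [|h dh] := bincop_factor (x := x) (bincop_sym X_sum).
  move=> V k y xk; apply: (bincop_disjoint (x := a ∘ y) (y := s ∘ k) Y_sum).
  by rewrite !compA -cu -xs -!compA xk.
rewrite -dh; congr (_ ∘ _); apply: (bincop_monor Y_sum).
by rewrite -xs -dh compA cd.
Qed.

End SumMap.

(** * Epimorphisms, pushouts and extensions in a Boolean pretopos *)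

Hypothesis C_boolean : boolean C.

(* Morphisms to 1+1 separate the image of e from its complement, so it is
   enough to test cancellation against pairs that are constant on e. *)
Lemma regular_epi_of_two (T : terminal C) (S : C) (i1 i2 : hom T S)
    (P Q : C) (e : hom P Q) :
  is_binary_coproduct i1 i2 ->
  (forall f g : hom Q S,
     f ∘ e = i1 ∘ tmap T P -> g ∘ e = i1 ∘ tmap T P -> f = g) ->
  regular_epi e.
Proof.
move=> cS eS.
have [I [e' [m [eq_e re' mm]]]] := pretopos_factorizations C_pretopos e.
have [D [d cQ]] := C_boolean mm.
(* [f] is the characteristic map of the image of [e]. By hypothesis it equals the constant map at
   [i1], so [i1] and [i2] agree on the complement [D], which is therefore initial. *)
have [f [[fm fd] _]] := cQ _ (i1 ∘ tmap T I) (i2 ∘ tmap T D).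
have fg : f = i1 ∘ tmap T Q.
  apply: eS; last by rewrite -compA; congr (_ ∘ _); exact: terminal_hom_eq.
  by rewrite eq_e compA fm -compA; congr (_ ∘ _); exact: terminal_hom_eq.
have D0 : is_initial D.
  by apply: (bincop_disjoint cS (x := tmap T Q ∘ d)); rewrite compA -fg fd.
by rewrite eq_e; apply: regular_epi_iso_comp (bincop_initial_iso cQ D0).
Qed.

(** Morphisms out of an initial [P] agree, so an epimorphism [e] makes the two constant maps from
    [Q] to [1 + 1] equal, and disjointness applies. This keeps the pullback in (A3) noninitial. *)
Lemma epi_initial (P Q : C) (e : hom P Q) :
  epi e -> is_initial P -> is_initial Q.
Proof.
move=> ee P0; have [T] := ex_terminal.
have [S [i1 [i2 cS]]] := ex_bincop T T.
apply: (bincop_disjoint cS (x := tmap T Q) (y := tmap T Q)).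
by apply: ee; exact: initial_hom_eq.
Qed.

Lemma ex_mono_pushout (A X B : C) (u : hom A X) (a : hom A B) : mono u ->
  exists (Y : C) (c : hom X Y) (v : hom B Y),
    [/\ is_pushout u a c v, mono v & is_pullback c v u a].
Proof.
move=> mu; have [D [d cX]] := C_boolean mu.
have [Y [v [w cY]]] := ex_bincop B D.
have [c [[cu cd] _]] := cX _ (v ∘ a) w.
exists Y, c, v; split; first exact: summap_pushout cX cY cu cd.
- exact: bincop_monol cY.
- exact: summap_pullback cX cY cu cd.
Qed.

Lemma ex_terminal_extension (T : terminal C) (A B : C) (j : hom T B) :
  epi (tmap T A) ->
  exists (E : C) (u : hom A E) (d : hom E B),
    [/\ mono u, epi d, is_pullback d j u (tmap T A) &
      forall (E' : C) (u' : hom A E') (d' : hom E' B),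
        is_pullback d' j u' (tmap T A) ->
        exists! h : hom E' E, h ∘ u' = u /\ d ∘ h = d'].
Proof.
move=> eA; have [B' [i cB]] := C_boolean (terminal_point_mono (x := j)).
have [E [u [w cE]]] := ex_bincop A B'.
have [d [[du dw] _]] := cE _ (j ∘ tmap T A) i.
exists E, u, d; split; first exact: bincop_monol cE.
(* On [A] the map [d] is [A -> 1] followed by [j], so [eA] settles the summand [1] of [B]; the
   summand [B'] is reached through [w]. *)
- move=> Z f g fg; apply: (bincop_hom_eq cB); last by rewrite -dw !compA fg.
  by apply: eA; rewrite -!compA -du !compA fg.
- exact: summap_pullback cE cB du dw.
(* The fibre of [d'] over [j] is [u'], so pulling [B = 1 + B'] back along [d'] gives [E' = A + D],
   and [h] can be defined on each summand. *)
move=> E' u' d' pb; have [D [p [q pb']]] := ex_pullback d' i.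
have cE' := bincop_stable cB pb pb'.
have [h [[hu hp] _]] := cE' _ u (w ∘ q).
exists h; split.
  split=> //; apply: (bincop_hom_eq cE'); rewrite -compA ?hu ?hp.
    by rewrite du pb.1.
  by rewrite compA dw pb'.1.
move=> h' [h'u dh']; apply: (bincop_hom_eq cE'); rewrite ?hu ?hp ?h'u //.
(* There is no choice on [D], because [d] is an isomorphism over [B']. *)
by symmetry; apply: (summap_fiber cE cB du dw); rewrite compA dh' pb'.1.
Qed.

End BooleanPretopos.

(** * Pointed objects *)

Section PointedObjects.
Variables (C : category) (T : terminal C).
Hypotheses (C_pretopos : pretopos C) (C_boolean : boolean C).
Local Notation K := (pointed_objects T).

Lemma ptd_sval_comp (X Y Z : K) (g : hom Y Z) (f : hom X Y) :
  sval (g ∘ f) = sval g ∘ sval f.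
Proof. by []. Qed.

Definition ptd_mk (X Y : K) (f : hom (ptd_val X) (ptd_val Y))
  (fP : f ∘ ptd_pt X = ptd_pt Y) : hom X Y := exist _ f fP.

Lemma ptd_epi (X Y : K) (e : hom X Y) : epi (sval e) -> epi e.
Proof.
move=> ee Z f g fg; apply: ptd_hom_inj; apply: ee.
exact: (congr1 (@sval _ _) fg).
Qed.

(** With [1 + 1] pointed at [i1], every map that is constantly [i1] after [e] is pointed, because
    the base point of [Y] factors through [e]. So the test maps of [regular_epi_of_two] live in
    [K]. *)
Lemma ptd_epi_regular (X Y : K) (e : hom X Y) : epi e -> regular_epi (sval e).
Proof.
move=> ee; have [S [i1 [i2 cS]]] := ex_bincop C_pretopos T T.
apply: (regular_epi_of_two C_pretopos C_boolean cS) => f g fe ge.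
pose S' : K := PtdObj i1.
have pt (h : hom (ptd_val Y) S) :
    h ∘ sval e = i1 ∘ tmap T (ptd_val X) -> h ∘ ptd_pt Y = ptd_pt S'.
  move=> he; rewrite -(svalP e) compA he -compA.
  by rewrite (terminal_hom_eq (_ ∘ _) (idm T)) comp_idr.
have fg : @ptd_mk Y S' f (pt f fe) = @ptd_mk Y S' g (pt g ge).
  by apply: ee; apply: ptd_hom_inj; rewrite !ptd_sval_comp /= fe ge.
exact: (congr1 (@sval _ _) fg).
Qed.

(** [W + 1] is the free pointed object on [W]: arbitrary maps out of [W] become pointed maps out of
    it, to which cancellation in [K] applies. *)
Lemma ptd_mono_sval (X Y : K) (m : hom X Y) : mono m -> mono (sval m).
Proof.
move=> mm W f g fg; have [S [k [l cS]]] := ex_bincop C_pretopos W T.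
pose S' : K := PtdObj l.
have [f' [[f'k f'l] _]] := cS _ f (ptd_pt X).
have [g' [[g'k g'l] _]] := cS _ g (ptd_pt X).
have : @ptd_mk S' X f' f'l = @ptd_mk S' X g' g'l.
  apply: mm; apply: ptd_hom_inj; rewrite !ptd_sval_comp /=.
  by apply: (bincop_hom_eq cS); rewrite -!compA ?f'k ?g'k ?f'l ?g'l.
by move=> /(congr1 (@sval _ _)) /= fg'; rewrite -f'k fg' g'k.
Qed.

Lemma ptd_strong_mono (X Y : K) (m : hom X Y) :
  mono (sval m) -> strong_mono m.
Proof.
move=> mm; split=> [W f g fg|P Q e a b /ptd_epi_regular re mab].
  by apply: ptd_hom_inj; apply: mm; exact: (congr1 (@sval _ _) fg).
have [l [le ml]] :=
  regular_epi_mono_lift re mm (congr1 (@sval _ _) mab).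
have lP : l ∘ ptd_pt Q = ptd_pt X by rewrite -(svalP e) compA le (svalP a).
by exists (@ptd_mk Q X l lP); split; apply: ptd_hom_inj.
Qed.

Lemma ptd_pullback (X Y Z P : K) (f : hom X Z) (g : hom Y Z) (p : hom P X)
    (q : hom P Y) :
  is_pullback (sval f) (sval g) (sval p) (sval q) -> is_pullback f g p q.
Proof.
move=> [fp pb]; split=> [|W a b ab]; first exact: ptd_hom_inj.
have [h [[ph qh] hu]] := pb _ _ _ (congr1 (@sval _ _) ab).
(* Both sides are induced by the cone formed by the base points of [X] and [Y]. *)
have hP : h ∘ ptd_pt W = ptd_pt P.
  have [|h' [_ hu']] := pb _ (ptd_pt X) (ptd_pt Y).
    by rewrite (svalP f) (svalP g).
  rewrite -(hu' (h ∘ _)) ?(hu' (ptd_pt P)) //; first by rewrite (svalP p) (svalP q).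
  by rewrite !compA ph qh (svalP a) (svalP b).
exists (@ptd_mk _ _ h hP); split; first by split; apply: ptd_hom_inj.
move=> h' [ph' qh']; apply: ptd_hom_inj; apply: hu.
by split; [rewrite -ph'|rewrite -qh'].
Qed.

(** The free pointed object [W + 1] turns a cone with vertex [W] into a pointed one. *)
Lemma ptd_pullback_sval (X Y Z P : K) (f : hom X Z) (g : hom Y Z) (p : hom P X)
    (q : hom P Y) :
  is_pullback f g p q -> is_pullback (sval f) (sval g) (sval p) (sval q).
Proof.
move=> [fp pb]; split=> [|W a b ab]; first exact: (congr1 (@sval _ _) fp).
have [S [k [l cS]]] := ex_bincop C_pretopos W T.
pose S' : K := PtdObj l.
have [a' [[a'k a'l] _]] := cS _ a (ptd_pt X).
have [b' [[b'k b'l] _]] := cS _ b (ptd_pt Y).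
have [|h [[ph qh] hu]] := pb S' (@ptd_mk S' X a' a'l) (@ptd_mk S' Y b' b'l).
  apply: ptd_hom_inj; rewrite !ptd_sval_comp /=.
  apply: (bincop_hom_eq cS); rewrite -!compA ?a'k ?b'k ?a'l ?b'l //.
  by rewrite (svalP f) (svalP g).
exists (sval h ∘ k); split.
  by rewrite !compA -!ptd_sval_comp ph qh.
move=> h1 [ph1 qh1]; have [h2 [[h2k h2l] _]] := cS _ h1 (ptd_pt P).
rewrite (hu (@ptd_mk S' P h2 h2l)) //.
by split; apply: ptd_hom_inj; rewrite ptd_sval_comp /=;
  apply: (bincop_hom_eq cS);
  rewrite -compA ?h2k ?h2l ?a'k ?b'k ?a'l ?b'l ?(svalP p) ?(svalP q).
Qed.

Lemma ptd_tmap_pt (X : K) : tmap T (ptd_val X) ∘ ptd_pt X = idm T.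
Proof. exact: terminal_hom_eq. Qed.

Definition ptd_terminal : terminal K.
Proof.
exists (PtdObj (idm T)) (fun X => @ptd_mk X (PtdObj (idm T)) _ (ptd_tmap_pt X)).
by move=> X f; apply: ptd_hom_inj; exact: terminal_hom_eq.
Defined.

(** The terminal pointed object is also initial, so every object has only one point; the clause of
    (A5) on exceptional points is then immediate. *)
Lemma ptd_point_eq (Y : K) (y y' : hom ptd_terminal Y) : y = y'.
Proof.
apply: ptd_hom_inj.
by rewrite -(comp_idr (sval y)) -(comp_idr (sval y')) (svalP y) (svalP y').
Qed.

Lemma pointed_objects_A1_A6 : satisfies_A1_A6 K.
Proof.
exists ptd_terminal; split.
- move=> X Y f.
  have [I [e [m [eq_f re mm]]]] := pretopos_factorizations C_pretopos (sval f).
  pose I' : K := PtdObj (e ∘ ptd_pt X).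
  have mP : m ∘ ptd_pt I' = ptd_pt Y by rewrite /= compA -eq_f (svalP f).
  exists I', (@ptd_mk X I' e erefl), (@ptd_mk I' Y m mP); split.
  + exact: ptd_hom_inj.
  + exact/ptd_epi/regular_epi_epi.
  + exact: ptd_strong_mono.
- move=> X Y B d v ed [mv _].
  have [P [p [q pb]]] := ex_pullback C_pretopos (sval d) (sval v).
  have [|x [[px qx] _]] := pb.2 _ (ptd_pt X) (ptd_pt B).
    by rewrite (svalP d) (svalP v).
  exists (PtdObj x), (@ptd_mk (PtdObj x) X p px), (@ptd_mk (PtdObj x) B q qx).
  split; first exact: ptd_pullback.
  by apply: ptd_epi; exact: epi_stable (ptd_epi_regular ed) pb.
- move=> A X B u a [mu _] ea.
  have [Y [c [v [po mv pb]]]] :=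
    ex_mono_pushout C_pretopos C_boolean (sval a) (ptd_mono_sval mu).
  pose Y' : K := PtdObj (v ∘ ptd_pt B).
  have cP : c ∘ ptd_pt X = ptd_pt Y'.
    by rewrite /= -(svalP u) compA po.1 -compA (svalP a).
  exists Y', (@ptd_mk X Y' c cP), (@ptd_mk B Y' v erefl); split.
  + split=> [|Z f g fg]; first exact/ptd_hom_inj/po.1.
    have [h [[hc hv] hu]] := po.2 _ _ _ (congr1 (@sval _ _) fg).
    have hP : h ∘ ptd_pt Y' = ptd_pt Z by rewrite /= compA hv (svalP g).
    exists (@ptd_mk Y' Z h hP); split; first by split; apply: ptd_hom_inj.
    move=> h' [h'c h'v]; apply: ptd_hom_inj; apply: hu.
    by split; [rewrite -h'c|rewrite -h'v].
  + exact: ptd_strong_mono.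
  + exact: ptd_pullback.
- move=> X Y X' Y' d u c v [ed _] _ po; split; first exact: epi_pushout po ed.
  by move=> y y' _ _; exact: ptd_point_eq.
- move=> A B j.
  (* The base point of [A] is a section of [A -> 1]. *)
  have eA : epi (tmap T (ptd_val A)).
    move=> Z f g fg; rewrite -(comp_idr f) -(comp_idr g) -(ptd_tmap_pt A).
    by rewrite !compA fg.
  have [E [u [d [mu ed pb uni]]]] :=
    ex_terminal_extension C_pretopos C_boolean (sval j) eA.
  pose E' : K := PtdObj (u ∘ ptd_pt A).
  have dP : d ∘ ptd_pt E' = ptd_pt B.
    by rewrite /= compA pb.1 -compA ptd_tmap_pt (svalP j).
  pose u' : hom A E' := @ptd_mk A E' u erefl.
  pose d' : hom E' B := @ptd_mk E' B d dP.
  have pb' : is_pullback d' j u' (tmap ptd_terminal A) by exact: ptd_pullback.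
  pose E0 : ext_category A j :=
    ExtObj (@ptd_strong_mono _ _ u' mu) (@ptd_epi _ _ d' ed) pb'.
  have ex (F : ext_category A j) : exists! h : hom F E0, True.
    have [h [[hu hd] huniq]] := uni _ _ _ (ptd_pullback_sval (ext_pullback F)).
    have hP : h ∘ ptd_pt (ext_val F) = ptd_pt E'.
      by rewrite -(svalP (ext_u F)) compA hu.
    pose h' : hom (ext_val F) E' := @ptd_mk (ext_val F) E' h hP.
    have hF : h' ∘ ext_u F = u' /\ d' ∘ h' = ext_d F.
      by split; apply: ptd_hom_inj.
    exists (exist _ h' hF : ext_hom F E0); split=> // -[k [ku kd]] _.
    apply: ext_hom_inj; apply: ptd_hom_inj; apply: huniq.
    by split; [exact: (congr1 (@sval _ _) ku)|exact: (congr1 (@sval _ _) kd)].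
  pose t F := cid (ex F).
  constructor; exists E0 (fun F => sval (t F)) => F f.
  by case: (t F) => g [_ gu] /=; rewrite (gu f).
Qed.

End PointedObjects.

(** * Noninitial objects of a nondegenerate two-valued pretopos *)

Section NoninitialObjects.
Variable C : category.
Hypotheses (C_pretopos : pretopos C) (C_boolean : boolean C).
Hypotheses (C_two : two_valued C) (C_nondegenerate : nondegenerate C).
Local Notation N := (noninitial_objects C).
Local Notation val := (@full_val _ _).

Lemma noninitial_codomain (X Y : C) (f : hom X Y) :
  ~ is_initial X -> ~ is_initial Y.
Proof. by move=> nX /(initial_strict C_pretopos f). Qed.

Lemma terminal_noninitial (T : terminal C) : ~ is_initial T.
Proof.
move=> T0; apply: (C_nondegenerate (T := T) (z := idm T) T0).
by exists (idm T); rewrite comp_idl.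
Qed.

(** The image of [A -> 1] is not initial, since [A] maps to it; two-valuedness makes it all of
    [1]. *)
Lemma noninitial_epi_terminal (T : terminal C) (A : C) :
  ~ is_initial A -> epi (tmap T A).
Proof.
move=> nA.
have [I [e [m [eq_t re mm]]]] := pretopos_factorizations C_pretopos (tmap T A).
rewrite eq_t; apply: regular_epi_epi; apply: regular_epi_iso_comp => //.
by case: (C_two mm) => // /(initial_strict C_pretopos e).
Qed.

Lemma noninitial_epi (X Y : N) (e : hom X Y) :
  epi (e : hom (val X) (val Y)) -> epi e.
Proof. by move=> ee Z f g; exact: ee. Qed.

(** By nondegeneracy [1 + 1] is noninitial, hence available in [N] as a test object. *)
Lemma noninitial_epi_regular (X Y : N) (e : hom X Y) :
  epi e -> regular_epi (e : hom (val X) (val Y)).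
Proof.
move=> ee; have [T] := ex_terminal C_pretopos.
have [S [i1 [i2 cS]]] := ex_bincop C_pretopos T T.
have nS := noninitial_codomain i1 (@terminal_noninitial T).
apply: (regular_epi_of_two C_pretopos C_boolean cS) => f g fe ge.
by apply: (ee (FullObj nS : N)); rewrite /= fe ge.
Qed.

(** Initial test objects lie outside [N], but any two parallel morphisms out of them agree. *)
Lemma noninitial_mono_val (X Y : N) (m : hom X Y) :
  mono m -> mono (m : hom (val X) (val Y)).
Proof.
move=> mm W f g; have [W0 _|nW] := pselect (is_initial W).
  exact: initial_hom_eq.
exact: (mm (FullObj nW : N)).
Qed.

Lemma noninitial_strong_mono (X Y : N) (m : hom X Y) :
  mono (m : hom (val X) (val Y)) -> strong_mono m.
Proof.
move=> mm; split=> [W f g|P Q e a b /noninitial_epi_regular re mab].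
  exact: mm.
exact: regular_epi_mono_lift re mm mab.
Qed.

Lemma noninitial_pullback (X Y Z P : N) (f : hom X Z) (g : hom Y Z)
    (p : hom P X) (q : hom P Y) :
  is_pullback (f : hom (val X) (val Z)) (g : hom (val Y) (val Z)) p q ->
  is_pullback f g p q.
Proof. by move=> [fp pb]; split=> // W; exact: pb. Qed.

Lemma noninitial_pullback_val (X Y Z P : N) (f : hom X Z) (g : hom Y Z)
    (p : hom P X) (q : hom P Y) :
  is_pullback f g p q ->
  is_pullback (f : hom (val X) (val Z)) (g : hom (val Y) (val Z)) p q.
Proof.
move=> [fp pb]; split=> // W a b ab.
have [W0|nW] := pselect (is_initial W); last exact: (pb (FullObj nW : N)).
have [h _] := W0 (val P).
by exists h; split=> [|h' _]; [split|]; exact: initial_hom_eq.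
Qed.

Lemma noninitial_pushout (A X B Q : N) (u : hom A X) (a : hom A B)
    (c : hom X Q) (v : hom B Q) :
  is_pushout (u : hom (val A) (val X)) (a : hom (val A) (val B)) c v ->
  is_pushout u a c v.
Proof. by move=> [cu po]; split=> // Z; exact: po. Qed.

Definition noninitial_terminal (T : terminal C) : terminal N.
Proof.
exists (FullObj (@terminal_noninitial T) : N) (fun X => tmap T (val X)).
by move=> X f; exact: tmap_uniq.
Defined.

Lemma noninitial_A5 (T : terminal C) : axiomA5 (noninitial_terminal T).
Proof.
move=> X Y X' Y' d u c v [ed d1] [mu _] po.
split; first exact: epi_pushout po ed.
have [D [i cX']] := C_boolean (noninitial_mono_val mu).
(* The given pushout is arbitrary, so the one constructed as a sum is compared with it: the
   isomorphism [k] carries the decomposition [Y + D] over to [Y']. *)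
have [Y0 [v0 [w0 cY0]]] := ex_bincop C_pretopos (val Y) D.
have [c0 [[c0u c0i] _]] := cX' _ (v0 ∘ (d : hom (val X) (val Y))) w0.
pose Y0' : N := FullObj (noninitial_codomain v0 (full_valP Y)).
have po0 : @is_pushout N X X' Y Y0' u d c0 v0.
  by apply: noninitial_pushout; exact: summap_pushout cX' cY0 c0u c0i.
have [k [[k' kK] kc kv]] := pushout_iso po0 po.
pose w : hom D (val Y') := (k : hom Y0 (val Y')) ∘ w0.
have cY' : is_binary_coproduct (v : hom (val Y) (val Y')) w.
  rewrite -kv; exact: (bincop_iso_comp cY0
    (ex_intro _ k' kK : is_iso (k : hom Y0 (val Y')))).
have ci : (c : hom (val X') (val Y')) ∘ i = w by rewrite /w -c0i -kc /= compA.
have cu := po.1 : (c : hom (val X') (val Y')) ∘ u = v ∘ d.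
have pb := noninitial_pullback (summap_pullback C_pretopos cX' cY' cu ci).
(* It suffices that every exceptional point of [c] comes from an exceptional point of [d], of which
   there is at most one. *)
suff pt (y : hom (noninitial_terminal T) Y') : ~ iso_over_point c y ->
    exists2 z : hom (noninitial_terminal T) Y,
      ~ iso_over_point d z & y = v ∘ z.
  move=> y y' /pt [z nz ->] /pt [z' nz' ->].
  by rewrite (d1 z z').
move=> ny.
(* The sum [Y' = Y + D] pulls back along [y] to [1 = P + Q], and two-valuedness makes [P] either
   initial or all of [1]. *)
have [P [p [q pbP]]] := ex_pullback C_pretopos (y : hom T (val Y')) v.
have [Q [p' [q' pbQ]]] := ex_pullback C_pretopos (y : hom T (val Y')) w.
have cT := bincop_stable C_pretopos cY' pbP pbQ.
case: (C_two (bincop_monol C_pretopos cT)) => [P0|[r [_ pr]]]; last first.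
  (* Here [y] lies in [Y]. By pasting, a fibre of [d] over [q ∘ r] is a fibre of [c] over [y], so
     the former cannot be an isomorphism. *)
  have yE : y = v ∘ (q ∘ r : hom (noninitial_terminal T) Y).
    by rewrite /= compA -pbP.1 -compA pr comp_idr.
  exists (q ∘ r) => // -[F [f [g [pbF ig]]]]; apply: ny.
  rewrite yE; exists F, (u ∘ f), g; split=> //; exact: pullback_paste pb pbF.
have [r [_ pr]] := bincop_initial_iso (bincop_sym cT) P0.
have yE : (y : hom T (val Y')) = w ∘ (q' ∘ r).
  by rewrite compA -pbQ.1 -compA pr comp_idr.
(* Here [y] lies in [D], over which [c] is an isomorphism; the fibre is [1], contradicting [ny]. *)
case: ny; exists (noninitial_terminal T : obj N), (i ∘ (q' ∘ r)), (idm T); split.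
  apply: noninitial_pullback; split.
    by rewrite yE comp_idr -ci; exact: compA.
  move=> W a b /=; rewrite yE -compA => ab; exists b; split.
    rewrite comp_idl -compA; split=> //; symmetry.
    exact: (summap_fiber C_pretopos cX' cY' cu ci).
  by move=> b' [_]; rewrite comp_idl.
by exists (idm T); rewrite /= comp_idl.
Qed.

Lemma noninitial_objects_A1_A6 : satisfies_A1_A6 N.
Proof.
have [T] := ex_terminal C_pretopos; exists (noninitial_terminal T); split.
- move=> X Y f.
  have [I [e [m [eq_f re mm]]]] :=
    pretopos_factorizations C_pretopos (f : hom (val X) (val Y)).
  pose I' : N := FullObj (noninitial_codomain e (full_valP X)).
  exists I', e, m; split=> //.
  + exact/noninitial_epi/regular_epi_epi.
  + exact: noninitial_strong_mono.
- move=> X Y B d v ed [mv _].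
  have [P [p [q pb]]] :=
    ex_pullback C_pretopos (d : hom (val X) (val Y)) (v : hom (val B) (val Y)).
  have eq := epi_stable C_pretopos (noninitial_epi_regular ed) pb.
  have nP : ~ is_initial P.
    by move=> /(epi_initial C_pretopos eq); exact: (full_valP B).
  exists (FullObj nP : N), p, q; split; first exact: noninitial_pullback.
  exact: noninitial_epi.
- move=> A X B u a [mu _] ea.
  have [Y [c [v [po mv pb]]]] := ex_mono_pushout C_pretopos C_boolean
    (a : hom (val A) (val B)) (noninitial_mono_val mu).
  pose Y' : N := FullObj (noninitial_codomain v (full_valP B)).
  exists Y', c, v; split; first exact: noninitial_pushout.
  + exact: noninitial_strong_mono.
  + exact: noninitial_pullback.
- exact: noninitial_A5.
- move=> A B j.
  have [E [u [d [mu ed pb uni]]]] := ex_terminal_extension C_pretopos C_boolean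
    (j : hom T (val B)) (@noninitial_epi_terminal T _ (full_valP A)).
  pose E' : N := FullObj (noninitial_codomain u (full_valP A)).
  have pb' : @is_pullback N _ _ _ _ (d : hom E' B) j (u : hom A E')
      (tmap (noninitial_terminal T) A) by exact: noninitial_pullback.
  pose E0 : ext_category A j :=
    ExtObj (@noninitial_strong_mono A E' u mu) (@noninitial_epi E' B d ed) pb'.
  have ex (F : ext_category A j) : exists! h : hom F E0, True.
    have [h [hP huniq]] := uni _ _ _ (noninitial_pullback_val (ext_pullback F)).
    exists (exist _ (h : hom (ext_val F) E') hP : ext_hom F E0); split=> // -[k kP] _.
    by apply: ext_hom_inj; exact: huniq.
  pose t F := cid (ex F).
  constructor; exists E0 (fun F => sval (t F)) => F f.
  by case: (t F) => g [_ gu] /=; rewrite (gu f).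
Qed.

End NoninitialObjects.

Theorem theorem4p9 :
  (forall C : category, pretopos C -> boolean C ->
     forall T : terminal C, satisfies_A1_A6 (pointed_objects T)) /\
  (forall C : category, pretopos C -> boolean C -> two_valued C ->
     nondegenerate C -> satisfies_A1_A6 (noninitial_objects C)).
Proof.
split=> [C pC bC T|C pC bC tC nC]; first exact: pointed_objects_A1_A6.
exact: noninitial_objects_A1_A6.
Qed.
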